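(* Let $\alpha\in\mathbb{D}$. Then $\{\alpha\}$ (i.e. $\{ev_\alpha\}\subset\mathcal{M}(H^\infty(\mathbb{D}))$) is not a $p$-set of $H^\infty(\mathbb{D})$. In particular, the maximal ideal $\ker ev_\alpha$ is not an $M$-ideal in $H^\infty(\mathbb{D})$.
   Context: $H^\infty(\mathbb{D})$ is the Banach algebra of bounded analytic functions on the open unit disc $\mathbb{D}$ with the supremum norm. $\mathcal{M}(H^\infty(\mathbb{D}))$ is its maximal ideal space (nonzero complex homomorphisms with the weak-$*$ topology). Via the isometric Gelfand map $f\mapsto\hat f$, $\hat f(\varphi)=\varphi(f)$, $H^\infty(\mathbb{D})$ is regarded as a uniform algebra on $K=\mathcal{M}(H^\infty(\mathbb{D}))$. For $\alpha\in\mathbb{D}$, $ev_\alpha(f)=f(\alpha)$ is the evaluation homomorphism, and $\alpha$ is identified with $ev_\alpha\in\mathcal{M}(H^\infty(\mathbb{D}))$. For a uniform algebra $A$ on a compact Hausdorff space $K$, a closed set $C\subseteq K$ is a peak set if there is $f\in A$ with $f|_C\equiv1$ and $|f(x)|<1$ for all $x\in K\setminus C$; a set $P\subseteq K$ is a $p$-set of $A$ if it is the intersection of a family of peak sets. $M$-ideal: a closed subspace $C$ of a complex Banach space $X$ is an $M$-ideal in $X$ if there is a bounded linear projection $P:X^*\to X^*$ ($P^2=P$) with $\operatorname{ran}P=C^\perp=\{x^*\in X^*: x^*|_C\equiv0\}$ and $\|Px^*\|+\|(I-P)x^*\|=\|x^*\|$ for all $x^*\in X^*$. *)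

(* Defs.v *)
From HB Require Import structures.
From mathcomp Require Import all_boot all_order all_algebra.
From mathcomp Require Import complex.
From mathcomp Require Import all_classical all_reals topology normedtype sequences.
Set Implicit Arguments.
Unset Strict Implicit.
Unset Printing Implicit Defensive.
Import Order.TTheory GRing.Theory Num.Theory numFieldNormedType.Exports.
Local Open Scope classical_set_scope.
Local Open Scope ring_scope.
Local Open Scope complex_scope.

(* MathComp-Analysis topologizes [R^o] for a [numFieldType] [R]; make this the
   canonical structure on the complex numbers [R[i]] as well. *)
HB.instance Definition _ (R : rcfType) := GRing.ComAlgebra.copy R[i] R[i]^o.
HB.instance Definition _ (R : rcfType) := Vector.copy R[i] R[i]^o.
HB.instance Definition _ (R : rcfType) := NormedModule.copy R[i] R[i]^o.

Section sup_norm.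
Variable R : realType.
Local Notation C := R[i].

(* Norms on complex vector spaces take values in [C]. *)
Definition sup_norm (T : Type) (A : set T) (f : T -> C) : C :=
  (sup [set complex.Re `|f t| | t in A])%:C.

Lemma Re_normK (x : C) : (complex.Re `|x|)%:C = `|x|.
Proof. by rewrite RRe_real// normr_real. Qed.

Lemma sup_norm_ub (T : Type) (A : set T) (f : T -> C) (M : C) t :
  (forall s, A s -> `|f s| <= M) -> A t -> `|f t| <= sup_norm A f.
Proof.
move=> fM At; rewrite -Re_normK lecR; apply: sup_upper_bound; last by exists t.
split; first by exists (complex.Re `|f t|), t.
exists (complex.Re M) => _ [s As <-].
by have := fM s As; rewrite lecE => /andP[].
Qed.

Lemma sup_norm_le (T : Type) (A : set T) (f : T -> C) (M : C) :
  A !=set0 -> (forall s, A s -> `|f s| <= M) -> sup_norm A f <= M.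
Proof.
move=> [t At] fM.
have M0 : 0 <= M by rewrite (le_trans _ (fM _ At)).
rewrite -(ger0_norm M0) -Re_normK lecR; apply: ge_sup.
  by exists (complex.Re `|f t|), t.
by move=> _ [s As <-]; rewrite -lecR !Re_normK (ger0_norm M0) fM.
Qed.

End sup_norm.

Section Hinf.
Variable R : realType.
Local Notation C := R[i].

Definition disc : set C := [set z | `|z| < 1].

Definition analytic (f : disc -> C) : Prop :=
  forall a : disc, exists (c : nat -> C) (r : C), 0 < r /\
    forall z : disc, `|val z - val a| < r ->
      [series c n * (val z - val a) ^+ n]_n @ \oo --> f z.

Definition bounded_on_disc (f : disc -> C) : Prop :=
  exists M : C, forall z, `|f z| <= M.

Lemma cvg_seqP (u : nat -> C) (l : C) :
  (u @ \oo --> l) <->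
  (forall e : C, 0 < e -> exists N, forall n, (N <= n)%N -> `|l - u n| < e).
Proof.
split=> [/cvgrPdist_lt ul e e0|H].
  by have [N _ NH] := ul e e0; exists N => n Nn; apply: NH.
apply/cvgrPdist_lt => e e0; have [N NH] := H e e0.
by exists N => // n /=; apply: NH.
Qed.

Lemma disc0_proof : (0 : C) \in disc.
Proof. by rewrite inE /disc/= normr0 ltr01. Qed.

Definition disc0 : disc := exist _ (0 : C) disc0_proof.

Lemma analytic_cst (k : C) : analytic (fun=> k).
Proof.
move=> a; exists (fun n => if n is 0 then k else 0), 1; split=> // z _.
apply/cvg_seqP => e e0; exists 1%N => -[//|n] _.
rewrite /series/= big_nat_recl// expr0 mulr1 big1 ?addr0 ?subrr ?normr0//.
by move=> i _; rewrite mul0r.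
Qed.

Lemma minC_gt0 (r s : C) : 0 < r -> 0 < s ->
  exists2 t : C, 0 < t & t <= r /\ t <= s.
Proof.
move=> r0 s0; have rs : r >=< s by rewrite real_comparable// gtr0_real.
by case/orP: rs => h; [exists r|exists s].
Qed.

Lemma analytic_lin (k : C) (f g : disc -> C) :
  analytic f -> analytic g -> analytic (k *: f + g).
Proof.
move=> fa ga a; have [c [r [r0 cf]]] := fa a; have [d [s [s0 dg]]] := ga a.
have [t t0 [tr ts]] := minC_gt0 r0 s0.
exists (fun n => k * c n + d n), t; split=> // z zt.
have {}cf := cf z (lt_le_trans zt tr); have {}dg := dg z (lt_le_trans zt ts).
have lim := cvgD (cvgM (cvg_cst k) cf) dg.
rewrite (_ : [series _]_n = cst k * [series c n * (val z - val a) ^+ n]_n +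
    [series d n * (val z - val a) ^+ n]_n); first exact: lim.
apply/funext => n; rewrite !fctE /series/= mulr_sumr -big_split/=.
by apply: eq_bigr => i _; rewrite mulrDl -mulrA.
Qed.

Lemma cauchy_product (F : nat -> nat -> C) N :
  \sum_(0 <= n < N) \sum_(0 <= i < n.+1) F i (n - i)%N =
  \sum_(0 <= i < N) \sum_(0 <= j < N - i) F i j.
Proof.
elim: N => [|N IH]; first by rewrite !big_geq.
rewrite big_nat_recr//= IH [RHS]big_nat_recr//= subSnn big_nat1.
rewrite big_nat_recr//= subnn addrA; congr (_ + _).
rewrite -big_split/=; apply: eq_big_nat => i /andP[_ iN].
by rewrite subSn ?(ltnW iN)// big_nat_recr.
Qed.

Lemma cvg_bounded (u : nat -> C) (l : C) : u @ \oo --> l ->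
  exists2 B : C, 0 < B & forall n, `|u n| <= B.
Proof.
move/cvg_seqP => /(_ 1 ltr01)[N HN].
have fin : exists2 B : C, 0 < B & forall n, (n < N)%N -> `|u n| <= B.
  elim: N {HN} => [|N [B B0 BH]]; first by exists 1.
  exists (B + `|u N|) => [|n]; first by rewrite ltr_pwDl.
  rewrite ltnS leq_eqVlt => /orP[/eqP->|/BH h]; first by rewrite lerDr ltW.
  by rewrite (le_trans h)// lerDl.
have [B B0 BH] := fin; exists (B + (1 + `|l|)) => [|n].
  by rewrite addr_gt0// ltr_pwDl.
have [nN|Nn] := ltnP n N.
  by rewrite (le_trans (BH _ nN))// lerDl addr_ge0.
apply: (@le_trans _ _ (1 + `|l|)); last by rewrite lerDr ltW.
rewrite -[u n](subKr l) (le_trans (ler_normB _ _))// addrC lerD2r.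
exact/ltW/HN.
Qed.

Lemma series_terms_bounded (c : nat -> C) (w l : C) :
  [series c n * w ^+ n]_n @ \oo --> l ->
  exists2 B : C, 0 < B & forall n, `|c n| * `|w| ^+ n <= B.
Proof.
move=> /cvg_bounded[B B0 BH]; exists (B + B) => [|n]; first exact: addr_gt0.
rewrite -normrX -normrM (_ : c n * w ^+ n = series (fun n => c n * w ^+ n) n.+1
  - series (fun n => c n * w ^+ n) n); last by rewrite /series/= big_nat_recr//= addrC addrK.
by rewrite (le_trans (ler_normB _ _))// lerD.
Qed.

Lemma leq_exp2 n : (n <= 2 ^ n)%N. Proof. exact/ltnW/ltn_expl. Qed.

Lemma half_pow_small (e : C) : 0 < e ->
  exists N, forall n, (N <= n)%N -> (2^-1 : C) ^+ n < e.
Proof.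
move=> e0; have /complex_realP[x xe] : e \is Num.real by exact: gtr0_real.
move: e0; rewrite xe ltcR => x0.
have [N xN] : exists N : nat, x^-1 < N%:R.
  by exists (Num.bound x^-1); rewrite archi_boundP// invr_ge0 ltW.
exists N => n Nn; rewrite exprVn.
rewrite -(@ltr_pM2r _ ((2 : C) ^+ n)) ?exprn_gt0// mulVf ?expf_neq0 ?pnatr_eq0//.
have -> : (2 : C) ^+ n = ((2 : R) ^+ n)%:C by rewrite rmorphXn/= rmorph_nat.
rewrite -[1](rmorph1 (real_complex R)) -rmorphM/= ltcR -ltr_pdivrMl// mulr1.
apply: (lt_le_trans xN); rewrite -natrX ler_nat.
exact: leq_trans Nn (leq_exp2 n).
Qed.

Lemma cauchy_tail (c d : nat -> C) (w B : C) (s : C) : 0 < s -> 0 < B ->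
  (forall n, `|c n| * s ^+ n <= B) -> (forall n, `|d n| * s ^+ n <= B) ->
  `|w| <= s * 8^-1 -> forall N,
  `|series (fun n => c n * w ^+ n) N * series (fun n => d n * w ^+ n) N -
    series (fun n => (\sum_(0 <= i < n.+1) c i * d (n - i)%N) * w ^+ n) N| <=
  B * B * 2^-1 ^+ N.
Proof.
move=> s0 B0 cB dB ws N; pose F i j := (c i * w ^+ i) * (d j * w ^+ j).
have -> : series (fun n => (\sum_(0 <= i < n.+1) c i * d (n - i)%N) * w ^+ n) N
    = \sum_(0 <= i < N) \sum_(0 <= j < N - i) F i j.
  rewrite -cauchy_product /series/=; apply: eq_bigr => n _.
  rewrite mulr_suml; apply: eq_big_nat => i /andP[_]; rewrite ltnS => ilen.
  by rewrite /F mulrACA -exprD subnKC.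
have -> : series (fun n => c n * w ^+ n) N * series (fun n => d n * w ^+ n) N
    = \sum_(0 <= i < N) \sum_(0 <= j < N) F i j.
  by rewrite /series/= mulr_suml; apply: eq_bigr => i _; rewrite mulr_sumr.
have q0 : 0 <= (8^-1 : C) by rewrite invr_ge0.
have q1 : (8^-1 : C) <= 1 by rewrite invf_le1 ?ler1n.
have term (e : nat -> C) (eB : forall n, `|e n| * s ^+ n <= B) n :
    `|e n * w ^+ n| <= B * 8^-1 ^+ n.
  rewrite normrM normrX (@le_trans _ _ (`|e n| * (s * 8^-1) ^+ n))//.
    by rewrite ler_wpM2l// lerXn2r// ?nnegrE// mulr_ge0// ltW.
  by rewrite exprMn mulrA ler_wpM2r// exprn_ge0.
rewrite -sumrB.
have -> : \sum_(0 <= i < N) (\sum_(0 <= j < N) F i j -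
      \sum_(0 <= j < N - i) F i j)
    = \sum_(0 <= i < N) \sum_(N - i <= j < N) F i j.
  apply: eq_bigr => i _.
  by rewrite (big_cat_nat (n := (N - i)%N)) ?leq_subr//= addrC addrK.
have row i : (i < N)%N ->
    `|\sum_(N - i <= j < N) F i j| <= (B * B * 8^-1 ^+ N) *+ N.
  move=> iN; rewrite (le_trans (ler_norm_sum _ _ _))//.
  apply: (@le_trans _ _ (\sum_(N - i <= j < N) (B * B * 8^-1 ^+ N))).
    apply: ler_sum_nat => j /andP[ij _]; rewrite /F normrM.
    apply: (@le_trans _ _ ((B * 8^-1 ^+ i) * (B * 8^-1 ^+ j))).
      by apply: ler_pM => //; exact: term.
    rewrite mulrACA -exprD ler_wpM2l ?mulr_ge0 ?(ltW B0)//.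
    by apply: ler_wiXn2l => //; rewrite -leq_subLR.
  rewrite sumr_const_nat subKn ?(ltnW iN)//.
  by rewrite ler_wpMn2l ?(ltnW iN)// mulr_ge0 ?exprn_ge0// mulr_ge0 ?(ltW B0).
rewrite (le_trans (ler_norm_sum _ _ _))//.
apply: (@le_trans _ _ (\sum_(0 <= i < N) (B * B * 8^-1 ^+ N) *+ N)).
  by apply: ler_sum_nat => i /andP[_]; exact: row.
rewrite sumr_const_nat subn0 -mulrnA -(mulr_natr _ (N * N)) -(mulrA (B * B)) ler_wpM2l//.
  by rewrite mulr_ge0 ?(ltW B0).
apply: (@le_trans _ _ (8^-1 ^+ N * (4 ^ N)%:R)).
  rewrite ler_wpM2l ?exprn_ge0// ler_nat (_ : 4 = 2 * 2)%N// expnMn.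
  by apply: leq_mul; exact: leq_exp2.
rewrite natrX -exprMn (_ : 8^-1 * 4%:R = 2^-1 :> C)//.
have -> : 8 = 2 * 4 :> C by rewrite -natrM.
by rewrite invfM mulfVK// pnatr_eq0.
Qed.

Lemma analytic_mul (f g : disc -> C) :
  analytic f -> analytic g -> analytic (f * g).
Proof.
move=> fa ga a; have [c [r1 [r10 cf]]] := fa a; have [d [r2 [r20 dg]]] := ga a.
have a1 : 0 < 1 - `|val a| by rewrite subr_gt0; exact: (set_valP a).
have [r3 r30 [r31 r32]] := minC_gt0 r10 r20.
have [r4 r40 [r43 r4a]] := minC_gt0 r30 a1.
pose s := r4 / 2; have s0 : 0 < s by rewrite divr_gt0.
have sr4 : s < r4 by rewrite ltr_pdivrMr// ltr_pMr// ltr1n.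
have zP : val a + s \in disc.
  rewrite inE /disc/=; apply: (le_lt_trans (ler_normD _ _)).
  by rewrite (gtr0_norm s0) -ltrBrDl (lt_le_trans sr4).
pose z0 : disc := exist _ (val a + s) zP.
have z0a : val z0 - val a = s by rewrite /= addrC addKr.
have sr3 := lt_le_trans sr4 r43.
have [B1 B10 cB] : exists2 B : C, 0 < B & forall n, `|c n| * s ^+ n <= B.
  have := @series_terms_bounded c s (f z0); rewrite (gtr0_norm s0); apply.
  rewrite -z0a; apply: cf; rewrite z0a (gtr0_norm s0); exact: lt_le_trans r31.
have [B2 B20 dB] : exists2 B : C, 0 < B & forall n, `|d n| * s ^+ n <= B.
  have := @series_terms_bounded d s (g z0); rewrite (gtr0_norm s0); apply.
  rewrite -z0a; apply: dg; rewrite z0a (gtr0_norm s0); exact: lt_le_trans r32.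
exists (fun n => \sum_(0 <= i < n.+1) c i * d (n - i)%N), (s * 8^-1).
split=> [|z zs]; first by rewrite mulr_gt0 ?invr_gt0.
have ss : s * 8^-1 <= s by rewrite ler_piMr ?(ltW s0)// invf_le1 ?ler1n.
have zr3 : `|val z - val a| < r3 by rewrite (lt_trans _ sr3)// (lt_le_trans zs).
have {}cf := cf z (lt_le_trans zr3 r31); have {}dg := dg z (lt_le_trans zr3 r32).
set w := val z - val a in zs zr3 cf dg *.
have B0 : 0 < B1 + B2 by exact: addr_gt0.
have tail := @cauchy_tail c d w (B1 + B2) s s0 B0
  (fun n => le_trans (cB n) (ler_wpDr (ltW B20) (lexx _)))
  (fun n => le_trans (dB n) (ler_wpDl (ltW B10) (lexx _))) (ltW zs).
pose v n : C := series (fun n => c n * w ^+ n) n * series (fun n => d n * w ^+ n) n.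
have prod : v @ \oo --> f z * g z by exact: cvgM cf dg.
set u := [series _]_n.
have uv0 : (fun n => v n - u n) @ \oo --> (0 : C).
  apply/cvg_seqP => e e0.
  have [N NH] := half_pow_small (divr_gt0 e0 (mulr_gt0 B0 B0)).
  exists N => n Nn; rewrite sub0r normrN; apply: (le_lt_trans (tail n)).
  by rewrite mulrC -ltr_pdivlMr ?mulr_gt0// NH.
have lim := cvgB prod uv0; rewrite subr0 in lim.
rewrite (_ : u = fun n => v n - (v n - u n)); first exact: lim.
by apply/funext => n; rewrite subKr.
Qed.

(* Functions on the disc, as opposed to functions on [C] restricted to it, so
   that the supremum norm is definite. *)
Definition Hinf_pred : {pred disc -> C} :=
  fun f => `[< analytic f /\ bounded_on_disc f >].

Lemma Hinf_predP f : reflect (analytic f /\ bounded_on_disc f) (f \in Hinf_pred).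
Proof. exact: asboolP. Qed.

Lemma Hinf_lin : linear_closed Hinf_pred.
Proof.
move=> k f g /Hinf_predP[fa [M fM]] /Hinf_predP[ga [N gN]]; apply/Hinf_predP.
split; first exact: analytic_lin.
exists (`|k| * M + N) => z; rewrite (le_trans (ler_normD _ _))// lerD//.
by rewrite normrM ler_wpM2l.
Qed.

Lemma Hinf_subring : subring_closed Hinf_pred.
Proof.
split.
- by apply/Hinf_predP; split; [exact: analytic_cst|exists `|1| => z].
- move=> f g fH gH; rewrite (_ : f - g = -1 *: g + f); first exact: Hinf_lin.
  by rewrite scaleN1r addrC.
- move=> f g /Hinf_predP[fa [M fM]] /Hinf_predP[ga [N gN]]; apply/Hinf_predP.
  split; first exact: analytic_mul.
  by exists (M * N) => z; rewrite normrM ler_pM.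
Qed.

Lemma Hinf_scale : GRing.scaler_closed Hinf_pred.
Proof.
move=> k f fH; rewrite -[k *: f]addr0; apply: Hinf_lin => //.
by have [h1 hB _] := Hinf_subring; rewrite -(subrr 1) hB.
Qed.

HB.instance Definition _ := GRing.isSubringClosed.Build _ Hinf_pred Hinf_subring.
HB.instance Definition _ := GRing.isScaleClosed.Build _ _ Hinf_pred Hinf_scale.

Record Hinf := MkHinf { Hinf_fun :> disc -> C ; HinfP : Hinf_fun \in Hinf_pred }.

HB.instance Definition _ := [isSub for Hinf_fun].
HB.instance Definition _ := [Choice of Hinf by <:].
HB.instance Definition _ :=
  GRing.SubChoice_isSubComPzRing.Build _ _ Hinf Hinf_subring.
HB.instance Definition _ := [SubZmodule_isSubLmodule of Hinf by <:].

Lemma Hinf_1neq0 : (1 : Hinf) != 0.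
Proof.
apply/eqP => /(congr1 (fun f : Hinf => f disc0)) /eqP; apply/negP.
exact: oner_neq0.
Qed.

HB.instance Definition _ := GRing.PzSemiRing_isNonZero.Build Hinf Hinf_1neq0.

Lemma Hinf_scalerAl (k : C) (f g : Hinf) : k *: (f * g) = k *: f * g.
Proof. by apply/val_inj/funext => z; exact: mulrA. Qed.

HB.instance Definition _ :=
  GRing.LSemiModule_isLSemiAlgebra.Build C Hinf Hinf_scalerAl.

Lemma Hinf_scalerAr (k : C) (f g : Hinf) : k *: (f * g) = f * (k *: g).
Proof. by apply/val_inj/funext => z; exact: mulrCA. Qed.

HB.instance Definition _ :=
  GRing.LSemiAlgebra_isSemiAlgebra.Build C Hinf Hinf_scalerAr.

Definition Hinf_norm (f : Hinf) : C := sup_norm setT f.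

Lemma Hinf_norm_ub (f : Hinf) z : `|f z| <= Hinf_norm f.
Proof.
by have /Hinf_predP[_ [M fM]] := HinfP f; apply: sup_norm_ub => // s _; exact: fM.
Qed.

Lemma Hinf_normD (f g : Hinf) : Hinf_norm (f + g) <= Hinf_norm f + Hinf_norm g.
Proof.
apply: sup_norm_le => [|z _]; first by exists disc0.
by rewrite (le_trans (ler_normD _ _))// lerD// Hinf_norm_ub.
Qed.

Lemma Hinf_norm_ge0 f : 0 <= Hinf_norm f.
Proof. exact: le_trans (Hinf_norm_ub f disc0). Qed.

Lemma Hinf_normZ k (f : Hinf) : Hinf_norm (k *: f) = `|k| * Hinf_norm f.
Proof.
have le (h : C) (g : Hinf) : Hinf_norm (h *: g) <= `|h| * Hinf_norm g.
  apply: sup_norm_le => [|z _]; first by exists disc0.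
  by rewrite normrM ler_wpM2l// Hinf_norm_ub.
have [->|k0] := eqVneq k 0.
  by apply/eqP; rewrite eq_le le normr0 mul0r Hinf_norm_ge0.
apply/eqP; rewrite eq_le le -ler_pdivlMl ?normr_gt0//= -normfV.
by rewrite -{1}[f](scalerK k0) le.
Qed.

Lemma Hinf_norm0_eq0 f : Hinf_norm f = 0 -> f = 0.
Proof.
move=> f0; apply/val_inj/funext => z; apply/eqP.
by rewrite -normr_le0 -f0 Hinf_norm_ub.
Qed.

HB.instance Definition _ :=
  Lmodule_isNormed.Build C Hinf Hinf_normD Hinf_normZ Hinf_norm0_eq0.

End Hinf.

Arguments disc : clear implicits.

Section spectrum.
Variable R : realType.
Local Notation C := R[i].

Definition complex_homomorphism : set {ptws Hinf R -> C} :=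
  [set phi | [/\ scalar phi, forall f g, phi (f * g) = phi f * phi g
                & exists f, phi f != 0]].

(* As a subtype of [{ptws Hinf R -> C}] it carries the topology of pointwise
   convergence, i.e. the weak-* topology. *)
Definition max_ideal_space : Type := complex_homomorphism.

HB.instance Definition _ := Topological.on max_ideal_space.

Lemma ev_homomorphism (a : disc R) :
  complex_homomorphism (fun f : Hinf R => f a).
Proof. by split=> //; exists 1; exact: oner_neq0. Qed.

Definition ev (a : disc R) : max_ideal_space :=
  exist _ (fun f : Hinf R => f a) (mem_set (ev_homomorphism a)).

Definition gelfand (f : Hinf R) : max_ideal_space -> C :=
  fun phi => (val phi : Hinf R -> C) f.

Definition gelfand_algebra : set (max_ideal_space -> C) := range gelfand.

Definition ker (phi : max_ideal_space) : set (Hinf R) :=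
  [set f | gelfand f phi = 0].

End spectrum.

Arguments gelfand_algebra : clear implicits.

Section p_set.
Variables (R : realType) (K : topologicalType) (A : set (K -> R[i])).

Definition peak_set (S : set K) : Prop :=
  closed S /\ exists f : K -> R[i],
    [/\ A f, forall x, S x -> f x = 1 & forall x, ~ S x -> `|f x| < 1].

Definition p_set (P : set K) : Prop :=
  exists F : set (set K),
    (forall S, F S -> peak_set S) /\ P = \bigcap_(S in F) S.

End p_set.

Section dual.
Variables (R : realType) (X : normedModType R[i]).
Local Notation C := R[i].

Definition dual_pred : {pred X -> C} := fun phi =>
  `[< scalar phi /\ exists M : C, forall x, `|phi x| <= M * `|x| >].

Lemma dual_predP phi :
  reflect (scalar phi /\ exists M : C, forall x, `|phi x| <= M * `|x|)
          (phi \in dual_pred).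
Proof. exact: asboolP. Qed.

Lemma dual_submod : submod_closed dual_pred.
Proof.
split.
  apply/dual_predP; split=> [k x y|]; first by rewrite mulr0 addr0.
  by exists 0 => x; rewrite normr0 mul0r.
move=> k f g /dual_predP[fl [M fM]] /dual_predP[gl [N gN]]; apply/dual_predP.
split=> [h x y|].
  rewrite !fctE fl gl/= !mulrDr addrACA; congr (_ + _).
  by rewrite {1}/GRing.scale/= !mulrDr mulrCA.
exists (`|k| * M + N) => x; rewrite (le_trans (ler_normD _ _))// mulrDl lerD//.
by rewrite normrM -mulrA ler_wpM2l.
Qed.

HB.instance Definition _ := GRing.isSubmodClosed.Build _ _ dual_pred dual_submod.

Record dual := MkDual { dual_fun :> X -> C ; dualP : dual_fun \in dual_pred }.

HB.instance Definition _ := [isSub for dual_fun].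
HB.instance Definition _ := [Choice of dual by <:].
HB.instance Definition _ := [SubChoice_isSubLmodule of dual by <:].

Definition dual_norm (phi : dual) : C := sup_norm [set x : X | `|x| <= 1] phi.

Lemma unit_ball_neq0 : [set x : X | `|x| <= 1] !=set0.
Proof. by exists 0; rewrite /= normr0 ler01. Qed.

Lemma dual_norm_ub (phi : dual) x : `|x| <= 1 -> `|phi x| <= dual_norm phi.
Proof.
move=> x1; have /dual_predP[_ [M phiM]] := dualP phi.
apply: (@sup_norm_ub _ _ _ _ `|M|) => // y y1.
have M0 : `|phi y| <= `|M| * `|y|.
  by rewrite -[`|y|]normr_id -normrM (le_trans (phiM y))// real_ler_norm//
    (ger0_real (le_trans _ (phiM y))).
by rewrite (le_trans M0)// ler_piMr.
Qed.

Lemma dual_normD (f g : dual) : dual_norm (f + g) <= dual_norm f + dual_norm g.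
Proof.
apply: sup_norm_le unit_ball_neq0 _ => x x1.
by rewrite (le_trans (ler_normD _ _))// lerD// dual_norm_ub.
Qed.

Lemma dual_norm_ge0 f : 0 <= dual_norm f.
Proof. by apply: le_trans (@dual_norm_ub f 0 _); rewrite ?normr0 ?ler01. Qed.

Lemma dual_normZ k (f : dual) : dual_norm (k *: f) = `|k| * dual_norm f.
Proof.
have le (h : C) (g : dual) : dual_norm (h *: g) <= `|h| * dual_norm g.
  apply: sup_norm_le unit_ball_neq0 _ => x x1.
  by rewrite normrM ler_wpM2l// dual_norm_ub.
have [->|k0] := eqVneq k 0.
  by apply/eqP; rewrite eq_le le normr0 mul0r dual_norm_ge0.
apply/eqP; rewrite eq_le le -ler_pdivlMl ?normr_gt0//= -normfV.
by rewrite -{1}[f](scalerK k0) le.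
Qed.

Lemma dual_norm0_eq0 f : dual_norm f = 0 -> f = 0.
Proof.
move=> f0; apply/val_inj/funext => x; apply/eqP => /=.
have /dual_predP[fl [M fM]] := dualP f.
have fZ k y : f (k *: y) = k * f y.
  have f00 : f 0 = 0 by apply/eqP; rewrite -normr_le0 (le_trans (fM 0))// normr0 mulr0.
  by rewrite -[k *: y]addr0 fl f00 addr0.
have [->|x0] := eqVneq x 0.
  by rewrite -normr_le0 (le_trans (fM 0))// normr0 mulr0.
have nx0 : `|x| != 0 by rewrite normr_eq0.
have : `|f (`|x|^-1 *: x)| <= 0.
  by rewrite -f0 dual_norm_ub// normrZ normfV normr_id mulVf.
by rewrite normr_le0 fZ mulf_eq0 invr_eq0 (negPf nx0).
Qed.

HB.instance Definition _ :=
  Lmodule_isNormed.Build C dual dual_normD dual_normZ dual_norm0_eq0.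

Definition annihilator (J : set X) : set dual :=
  [set phi | forall x, J x -> phi x = 0].

Definition closed_subspace (J : set X) : Prop :=
  [/\ closed J, J 0 & forall (k : C) x y, J x -> J y -> J (k *: x + y)].

Definition M_ideal (J : set X) : Prop :=
  closed_subspace J /\
  exists P : {linear dual -> dual},
    [/\ exists M : C, forall phi, `|P phi| <= M * `|phi|,
        forall phi, P (P phi) = P phi,
        range P = annihilator J
      & forall phi, `|P phi| + `|phi - P phi| = `|phi| ].

End dual.

Lemma ker_ev_closed_subspace (R : realType) (a : disc R) :
  closed_subspace (ker (ev a)).
Proof.
split=> [f clf|//|k f g]; last first.
  rewrite /ker/= /gelfand/= => fa ga; change (k * f a + g a = 0).
  by rewrite fa ga mulr0 addr0.
rewrite /ker/= /gelfand/=; apply: contrapT => /eqP fa0.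
have [|g [ga]] := clf (ball f `|f a|); first by apply: nbhsx_ballx; rewrite normr_gt0.
rewrite -ball_normE/= => fg; rewrite /ker/= /gelfand/= in ga.
have := Hinf_norm_ub (f - g) a.
rewrite (_ : (f - g) a = f a - g a)// ga subr0 => fle.
by have := le_lt_trans fle fg; rewrite ltxx.
Qed.

(* Main.v *)
Require Import Defs.
From mathcomp Require Import all_boot all_order all_algebra.
From mathcomp Require Import complex ring lra.
From mathcomp Require Import all_classical all_reals topology normedtype sequences.
From mathcomp Require Import derive.
Import Order.TTheory GRing.Theory Num.Theory numFieldNormedType.Exports.
Local Open Scope classical_set_scope.
Local Open Scope ring_scope.

(** Both assertions fail because the evaluations at [alpha] and at nearby points
    of the disc are close in the dual norm, uniformly over all bounded analytic
    functions, and even vary smoothly. The analytic input is a pair of uniform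
    estimates, valid when [f] is bounded by 1 on the disc:
    [`|f z - f alpha| <= K * `|z - alpha|], and
    [`|f (alpha + h) + f (alpha - h) - 2 * f alpha| <= K * `|h| ^+ 2], with [K]
    depending on [alpha] only ([Hinf_difference_le] and
    [Hinf_second_difference_le]).

    No integral formula is used for them. They follow from the Schwarz argument:
    the divided difference [(f z - f alpha) / (z - alpha)] is bounded away from
    [alpha], hence everywhere by the maximum principle, and the operation can be
    repeated. The maximum principle is proved for all functions with fourth order
    Taylor expansions, a class which contains the analytic functions and is
    stable, up to the order, under divided differences. For such [G] the mean of
    [G] over the four vertices [a + 'i ^+ k * h] equals its value at [a] up
    to [O(h ^+ 4)], so that [`|G z| + e * `|z - alpha| ^+ 2] has no local maximum
    when [e > 0] ([no_local_maximum]); compactness of a closed square around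
    [alpha] then gives [maximum_principle].

    If the evaluation at [alpha] were a p-set, every peak set of the family would
    come from some [f] bounded by 1 with [f alpha = 1]. The first estimate, applied
    to all powers of [f], keeps [f v ^+ n] within 1/2 of 1 for a fixed [v] close to
    [alpha], which forces [f v = 1]; so the evaluation at [v] belongs to all the
    peak sets as well.

    If the kernel were an M-ideal, its annihilator, the line spanned by the
    evaluation at [alpha], would be the range of an L-projection, which maps the
    evaluation at [z] to [c z] times that at [alpha]. The norm identity forces
    [c z] to be real, at most 1, with [1 - c z] comparable to the distance between
    the two evaluations. The second estimate bounds the second difference of [c]
    at its maximum [alpha] by [O(h ^+ 2)], so this distance is [O(h ^+ 2)] too;
    but the identity function shows that it is at least [`|h|]. *)

Section point_evaluations.
Context {R : realType}.
Local Notation C := R[i].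
Local Open Scope complex_scope.

(** * Taylor expansions with bounded remainder *)

(** [F] is a polynomial of degree less than [n] in [z - a] plus [(z - a) ^+ n]
    times a function bounded near [a]. The Horner-like recursion makes closure
    under products and divided differences a plain induction, and these
    expansions, unlike power series, pass to divided differences without any
    rearrangement of series. *)
Fixpoint taylor (n : nat) (a : C) (F : C -> C) : Prop :=
  if n is m.+1 then
    exists c : C, exists2 G : C -> C, taylor m a G &
      \forall z \near a, F z = c + (z - a) * G z
  else exists M : C, \forall z \near a, `|F z| <= M.

Lemma near_dist (a e : C) : 0 < e -> \forall z \near a, `|z - a| < e.
Proof.
move=> e0; apply/nbhs_ballP; exists e => //= z; rewrite -ball_normE/= distrC.
by [].
Qed.

Lemma near_distP (a : C) (P : C -> Prop) : (\forall z \near a, P z) ->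
  exists2 e : C, 0 < e & forall z, `|z - a| < e -> P z.
Proof.
move=> /nbhs_ballP[e /= e0 eP]; exists e => // z za; apply: eP.
by rewrite -ball_normE/= distrC.
Qed.

Lemma taylor_value a c (F G : C -> C) :
  (\forall z \near a, F z = c + (z - a) * G z) -> F a = c.
Proof. by move=> /nbhs_singleton ->; rewrite subrr mul0r addr0. Qed.

Lemma taylor_bounded n a F : taylor n a F -> taylor 0 a F.
Proof.
elim: n F => // n IH F [c [G /IH[M GM] FE]]; exists (`|c| + M).
have d1 := near_dist a _ (ltr01 : (0 : C) < 1).
apply: filterS3 GM FE d1 => z GM -> d1.
rewrite (le_trans (ler_normD _ _))// lerD2l normrM.
apply: (le_trans _ GM); rewrite ler_piMl//; exact: ltW.
Qed.

Lemma taylorW n a F : taylor n.+1 a F -> taylor n a F.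
Proof.
elim: n F => [F /taylor_bounded//|n IH F [c [G /IH Gn FE]]].
by exists c, G.
Qed.

Lemma taylor_cst n a c : taylor n a (fun=> c).
Proof.
elim: n c => [c|n IH c]; first by exists `|c|; apply: filterE => z; rewrite lexx.
by exists c, (fun=> 0) => //; apply: filterE => z; rewrite mulr0 addr0.
Qed.

Lemma taylor_eq_near n a F G :
  (\forall z \near a, G z = F z) -> taylor n a F -> taylor n a G.
Proof.
move=> GF; case: n => [[M FM]|n [c [H Hn FE]]].
  by exists M; apply: filterS2 GF FM => z ->.
by exists c, H => //; apply: filterS2 GF FE => z ->.
Qed.

Lemma taylorD n a F G :
  taylor n a F -> taylor n a G -> taylor n a (fun z => F z + G z).
Proof.
elim: n F G => [F G [M FM] [N GN]|n IH F G [c [F1 F1n FE]] [d [G1 G1n GE]]].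
  exists (M + N); apply: filterS2 FM GN => z FM GN.
  by rewrite (le_trans (ler_normD _ _))// lerD.
exists (c + d), (fun z => F1 z + G1 z); first exact: IH.
by apply: filterS2 FE GE => z -> ->; rewrite mulrDr addrACA.
Qed.

Lemma taylorM n a F G :
  taylor n a F -> taylor n a G -> taylor n a (fun z => F z * G z).
Proof.
elim: n F G => [F G [M FM] [N GN]|n IH F G].
  exists (M * N); apply: filterS2 FM GN => z FM GN.
  by rewrite normrM ler_pM.
move=> [c [F1 F1n FE]] Gn1; have Gn := taylorW _ _ _ Gn1.
have [d [G1 G1n GE]] := Gn1.
exists (c * d), (fun z => F1 z * G z + c * G1 z).
  by apply: taylorD; apply: IH => //; exact: taylor_cst.
by apply: filterS2 FE GE => z -> ->; ring.
Qed.

(** With [u = b - a] and [w = z - b], the expansion comes from iterating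
    [1 / (u + w) = 1 / u - (w / u) * (1 / (u + w))]. *)
Lemma taylor_inv n a b : b != a -> taylor n b (fun z => (z - a)^-1).
Proof.
move=> ba; have u0 : b - a != 0 by rewrite subr_eq0.
have near_u : \forall z \near b, `|b - a| / 2 <= `|z - a|.
  have e0 : 0 < `|b - a| / 2 by rewrite divr_gt0// normr_gt0.
  apply: filterS (near_dist b _ e0) => z zb.
  rewrite -(lerD2r `|z - b|) (@le_trans _ _ `|b - a|)//.
    by rewrite [leRHS](splitr `|b - a|) lerD2l ltW.
  by rewrite (_ : b - a = (z - a) - (z - b)) ?ler_normB//; ring.
elim: n => [|n IH].
  exists (`|b - a| / 2)^-1; apply: filterS near_u => z zu.
  by rewrite normfV lef_pV2// posrE ?(lt_le_trans _ zu) ?divr_gt0 ?normr_gt0.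
exists (b - a)^-1, (fun z => - (b - a)^-1 * (z - a)^-1).
  by apply: taylorM => //; exact: taylor_cst.
apply: filterS near_u => z zu.
have z0 : z - a != 0.
  by rewrite -normr_gt0 (lt_le_trans _ zu)// divr_gt0// normr_gt0.
by field; rewrite u0 z0.
Qed.

(** At [a] the quotient takes the value of the first Taylor remainder, so one
    order of expansion is lost there; elsewhere it is a product with
    [(z - a)^-1]. *)
Lemma taylor_divided_difference n (a : C) (F : C -> C) (D : set C) :
  D a -> (forall b, D b -> taylor n.+1 b F) ->
  exists2 G : C -> C, (forall b, D b -> taylor n b G) &
    forall z, F z = F a + (z - a) * G z.
Proof.
move=> Da Fn; have [c [F1 F1n FE]] := Fn a Da.
exists (fun z => if z == a then F1 a else (F z - F a) / (z - a)); last first.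
  move=> z; case: eqVneq => [->|za]; first by rewrite subrr mul0r addr0.
  by rewrite mulrC divfK ?subr_eq0// addrC subrK.
move=> b Db; have [->|ba] := eqVneq b a.
  apply: taylor_eq_near F1n; rewrite (taylor_value _ _ _ _ FE).
  apply: filterS FE => z ->; case: eqVneq => [->//|za].
  by rewrite addrC addKr mulrC mulKf ?subr_eq0.
apply: (@taylor_eq_near _ _ (fun z => (F z + (- F a)) * (z - a)^-1)).
  have u0 : 0 < `|b - a| by rewrite normr_gt0 subr_eq0.
  apply: filterS (near_dist b _ u0) => z; case: eqVneq => // ->.
  by rewrite distrC ltxx.
apply: taylorM; last exact: taylor_inv.
by apply: taylorD; [apply: taylorW; exact: Fn|exact: taylor_cst].
Qed.

(** * Analytic functions have Taylor expansions of every order *)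

(** The terms are dominated by [B * 2^-1 ^+ k], whose partial sums are
    [B * (2 - 2 * 2^-1 ^+ n)]. *)
Lemma series_le_geometric (c : nat -> C) (s B w : C) :
  0 < s -> (forall n, `|c n| * s ^+ n <= B) -> `|w| <= s / 2 ->
  forall n, `|series (fun k => c k * w ^+ k) n| <= B * 2.
Proof.
move=> s0 cB ws n.
have B0 : 0 <= B by apply: le_trans (cB 0%N); rewrite mulr_ge0.
have term k : `|c k * w ^+ k| <= B * 2^-1 ^+ k.
  rewrite normrM normrX (@le_trans _ _ (`|c k| * (s / 2) ^+ k))//.
    rewrite ler_wpM2l// lerXn2r// ?nnegrE//.
    by rewrite mulr_ge0 ?invr_ge0// ltW.
  by rewrite exprMn mulrA ler_wpM2r// exprn_ge0// invr_ge0.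
apply: (@le_trans _ _ (B * (2 - 2 * 2^-1 ^+ n))); last first.
  rewrite ler_wpM2l// gerBl mulr_ge0// exprn_ge0// invr_ge0//.
elim: n => [|n IH].
  by rewrite /series/= big_geq// normr0 expr0 mulr1 subrr mulr0.
rewrite /series/= big_nat_recr//= (le_trans (ler_normD _ _))//.
rewrite (le_trans (lerD IH (term n)))// -mulrDr exprS.
by rewrite le_eqVlt; apply/orP; left; apply/eqP; congr (_ * _); field.
Qed.

Lemma cvg_norm_le (u : nat -> C) (l B : C) :
  u @ \oo --> l -> (forall n, `|u n| <= B) -> `|l| <= B.
Proof.
move=> /cvg_seqP ul uB.
have B0 : B \is Num.real by rewrite ger0_real// (le_trans _ (uB 0%N)).
rewrite real_leNgt// ?normr_real//; apply/negP => Bl.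
have [N /(_ N (leqnn N)) Nl] := ul (`|l| - B) (ltac:(by rewrite subr_gt0)).
have := le_lt_trans (le_trans (lerB (lexx `|l|) (uB N)) (lerB_dist l (u N))) Nl.
by rewrite ltxx.
Qed.

(** Removing the constant term and dividing by [z - a] shifts the coefficients:
    the same bound holds with [B / s] for [B], which feeds the induction. *)
Lemma taylor_power_series n (a : C) (c : nat -> C) (s B : C) (F : C -> C) :
  0 < s -> (forall k, `|c k| * s ^+ k <= B) ->
  (\forall z \near a, series (fun k => c k * (z - a) ^+ k) @ \oo --> F z) ->
  taylor n a F.
Proof.
move=> s0; elim: n c B F => [|n IH] c B F cB cF.
  have s20 : 0 < s / 2 by rewrite divr_gt0.
  exists (B * 2); apply: filterS2 cF (near_dist a _ s20) => z cF za.
  by apply: cvg_norm_le cF _; apply: series_le_geometric (ltW za).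
have Fa : F a = c 0%N.
  have /cvg_seqP Fl := nbhs_singleton cF.
  apply/eqP/contraT => ne; have := Fl `|F a - c 0%N|.
  rewrite normr_gt0 subr_eq0 => /(_ ne)[N /(_ N.+1 (leqnSn N))].
  rewrite /series/= big_nat_recl// expr0 mulr1 big1 ?addr0 ?ltxx// => i _.
  by rewrite subrr expr0n mulr0.
pose F1 z := if z == a then c 1%N else (F z - c 0%N) / (z - a).
exists (c 0%N), F1; last first.
  apply: filterE => z; rewrite /F1; case: eqVneq => [->|za].
    by rewrite subrr mul0r addr0.
  by rewrite mulrC divfK ?subr_eq0// addrC subrK.
apply: (IH (fun k => c k.+1) (B / s)) => [k|].
  by rewrite ler_pdivlMr// -mulrA -exprSr.
apply: filterS cF => z cF; rewrite /F1; case: eqVneq => [za|za].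
  apply/cvg_seqP => e e0; exists 1%N => -[//|m] _.
  rewrite /series/= big_nat_recl// expr0 mulr1 big1 ?addr0 ?subrr ?normr0//.
  by move=> i _; rewrite za subrr expr0n mulr0.
have w0 : z - a != 0 by rewrite subr_eq0.
apply/cvg_seqP => e e0.
have nw : 0 < `|z - a| by rewrite normr_gt0.
have [N NH] := (cvg_seqP _ _).1 cF (e * `|z - a|) (mulr_gt0 e0 nw).
exists N => m Nm; have := NH m.+1 (leqW Nm).
rewrite -ltr_pdivrMr// -normfV -normrM; congr (`|_| < _).
rewrite /series/= big_nat_recl//= expr0 mulr1 opprD addrA [LHS]mulrBl.
congr (_ - _); rewrite mulr_suml; apply: eq_bigr => i _.
by rewrite exprSr mulrA mulfK.
Qed.

(** Extension by zero frees the points of the plane from membership proofs. *)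
Definition disc_ext (f : disc R -> C) (z : C) : C := oapp f 0 (insub z).

Lemma disc_extE (f : disc R -> C) (z : disc R) : disc_ext f (val z) = f z.
Proof. by rewrite /disc_ext valK. Qed.

Lemma near_disc (a : C) : disc R a -> \forall z \near a, disc R z.
Proof.
move=> aD; have d0 : 0 < 1 - `|a| by rewrite subr_gt0.
apply: filterS (near_dist a _ d0) => z zd; rewrite /disc/=.
by rewrite -[z](subrK a) (le_lt_trans (ler_normD _ _))// -ltrBrDr.
Qed.

Lemma taylor_analytic n (f : disc R -> C) (a : C) :
  analytic f -> disc R a -> taylor n a (disc_ext f).
Proof.
move=> fa aD; have [c [r [r0 cf]]] := fa (exist _ a (mem_set aD)).
have [t t0 tP] := near_distP _ _ (near_disc _ aD).
have [t' t'0 [t't t'r]] := minC_gt0 t0 r0.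
pose s := t' / 2; have s0 : 0 < s by rewrite divr_gt0.
have st' : s < t' by rewrite ltr_pdivrMr// ltr_pMr// ltr1n.
(* Convergence at the single point [a + s] bounds the coefficients. *)
have asD : disc R (a + s).
  by apply: tP; rewrite addrC addKr gtr0_norm// (lt_le_trans st').
have [B B0 cB] : exists2 B : C, 0 < B & forall k, `|c k| * s ^+ k <= B.
  rewrite -(gtr0_norm s0).
  apply: (@series_terms_bounded _ c s (f (exist _ (a + s) (mem_set asD)))).
  have /= := cf (exist _ (a + s) (mem_set asD)).
  by rewrite addrC addKr gtr0_norm//; apply; rewrite (lt_le_trans st').
apply: (taylor_power_series n a c s B) => //.
apply: filterS2 (near_disc _ aD) (near_dist a _ r0) => z zD zr.
have := cf (exist _ z (mem_set zD)) zr.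
by rewrite -(disc_extE f (exist _ z (mem_set zD))).
Qed.

(** * Strict subharmonicity *)

Lemma norm_i : `|'i : C| = 1.
Proof. by rewrite normc_def/= expr0n expr1n add0r sqrtr1. Qed.

Lemma norm_real (y : R) : `|y%:C| = `|y|%:C.
Proof. by rewrite normc_def/= expr0n addr0 sqrtr_sqr. Qed.

(** The four increments are [h] times the fourth roots of unity, whose first,
    second and third powers sum to 0; only the remainder of order 4 is left. *)
Lemma taylor4_four_points (a : C) (G : C -> C) : taylor 4 a G ->
  exists K : C, 0 <= K /\ exists2 d : C, 0 < d & forall h, `|h| < d ->
    `|G (a + h) + G (a + 'i * h) + G (a - h) + G (a - 'i * h) - 4 * G a|
      <= K * `|h| ^+ 4.
Proof.
move=> [c0 [G1 [c1 [G2 [c2 [G3 [c3 [H [M HM] E3]] E2]] E1]] E0]].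
have Ga := taylor_value _ _ _ _ E0.
have E : \forall z \near a, `|H z| <= M /\ G z = c0 + (z - a) * (c1 + (z - a) *
    (c2 + (z - a) * (c3 + (z - a) * H z))).
  near=> z; split; first by near: z.
  rewrite -(near E3 z)//; rewrite -(near E2 z)//; rewrite -(near E1 z)//.
  by rewrite -(near E0 z).
have [d d0 dE] := near_distP _ _ E.
exists (M *+ 4); split.
  by rewrite mulrn_wge0// (le_trans _ (nbhs_singleton HM)).
exists d => // h hd.
have ni : `|'i * h| = `|h|.
  by rewrite normrM norm_i mul1r.
have [h1 E1'] : `|H (a + h)| <= M /\ _ :=
  dE (a + h) (ltac:(by rewrite addrC addKr)).
have [h2 E2'] : `|H (a + 'i * h)| <= M /\ _ :=
  dE (a + 'i * h) (ltac:(by rewrite addrC addKr ni)).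
have [h3 E3'] : `|H (a - h)| <= M /\ _ :=
  dE (a - h) (ltac:(by rewrite addrC addKr normrN)).
have [h4 E4'] : `|H (a - 'i * h)| <= M /\ _ :=
  dE (a - 'i * h) (ltac:(by rewrite addrC addKr normrN ni)).
rewrite E1' E2' E3' E4' Ga.
have -> (H1 H2 H3 H4 i : C) : i ^+ 2 = -1 ->
  c0 + (a + h - a) * (c1 + (a + h - a) * (c2 +
    (a + h - a) * (c3 + (a + h - a) * H1))) +
  (c0 + (a + i * h - a) * (c1 + (a + i * h - a) * (c2 +
    (a + i * h - a) * (c3 + (a + i * h - a) * H2)))) +
  (c0 + (a - h - a) * (c1 + (a - h - a) * (c2 +
    (a - h - a) * (c3 + (a - h - a) * H3)))) +
  (c0 + (a - i * h - a) * (c1 + (a - i * h - a) * (c2 +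
    (a - i * h - a) * (c3 + (a - i * h - a) * H4))))
  - 4 * c0 = (H1 + H2 + H3 + H4) * h ^+ 4.
- move=> i2.
  transitivity (2 * (1 + i ^+ 2) * c2 * h ^+ 2 +
      (H1 + H3 + (i ^+ 2) ^+ 2 * (H2 + H4)) * h ^+ 4).
    by ring.
  by rewrite i2; ring.
- rewrite normrM normrX ler_wpM2r ?exprn_ge0//.
  rewrite !mulrS mulr0n addr0 !addrA.
  by do 3 (apply: (le_trans (ler_normD _ _)); apply: lerD => //).
- exact: sqr_i.
Unshelve. all: by end_near.
Qed.

Lemma sum_four_sqr_norm (u h : C) : 0 <= h ->
  `|u + h| ^+ 2 + `|u + 'i * h| ^+ 2 + `|u - h| ^+ 2 + `|u - 'i * h| ^+ 2 =
  4 * `|u| ^+ 2 + 4 * h ^+ 2.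
Proof.
move=> h0; have hr : conjc h = h.
  by have := ger0_Im h0; case: (h) => x y /= ->; rewrite oppr0.
have ii : conjc ('i : C) = - 'i by apply/eqP; rewrite eq_complex /= oppr0 !eqxx.
have JD (x y : C) : conjc (x + y) = conjc x + conjc y by exact: rmorphD.
have JB (x y : C) : conjc (x - y) = conjc x - conjc y by exact: rmorphB.
have JM (x y : C) : conjc (x * y) = conjc x * conjc y by exact: rmorphM.
rewrite !sqr_normc !JB !JD !JM hr ii.
transitivity (4 * (u * conjc u) + 2 * h ^+ 2 - 2 * ('i : C) ^+ 2 * h ^+ 2).
  by ring.
by rewrite sqr_i; ring.
Qed.

(** The mean of the function over the square [a + h], [a + 'i * h], [a - h],
    [a - 'i * h] exceeds its value at [a] by at least [e * h ^+ 2 - O(h ^+ 4)]: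
    the penalty contributes [e * h ^+ 2] and the mean of [`|G|] is at
    least [`|G a| - O(h ^+ 4)]. *)
Lemma no_local_maximum (a u e : C) (G : C -> C) : taylor 4 a G -> 0 < e ->
  ~ \forall z \near a,
    `|G z| + e * `|z - u| ^+ 2 <= `|G a| + e * `|a - u| ^+ 2.
Proof.
move=> /taylor4_four_points[K [K0 [d d0 HK]]] e0 /near_distP[d' d'0 Hmax].
have K1 : 0 < K + 1 by rewrite ltr_wpDl.
have [t t0 [td td']] := minC_gt0 d0 d'0.
have [t' t'0 [t't t'1]] := minC_gt0 t0 (ltr01 : (0 : C) < 1).
have [s s0 [st' se]] := minC_gt0 t'0 (divr_gt0 e0 K1).
pose h := s / 2; have h0 : 0 < h by rewrite divr_gt0.
have hs : h < s by rewrite ltr_pdivrMr// ltr_pMr// ltr1n.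
have nh : `|h| = h by rewrite gtr0_norm.
have ht : h < t by rewrite (lt_le_trans hs)// (le_trans st').
have ni : `|'i * h| = h.
  by rewrite normrM nh norm_i mul1r.
have h4 := HK h (ltac:(by rewrite nh (lt_le_trans ht))).
have hd' := lt_le_trans ht td'.
have m1 := Hmax (a + h) (ltac:(by rewrite addrC addKr nh)).
have m2 := Hmax (a + 'i * h) (ltac:(by rewrite addrC addKr ni)).
have m3 := Hmax (a - h) (ltac:(by rewrite addrC addKr normrN nh)).
have m4 := Hmax (a - 'i * h) (ltac:(by rewrite addrC addKr normrN ni)).
have := lerD (lerD (lerD m1 m2) m3) m4.
have sq := sum_four_sqr_norm (a - u) h (ltW h0).
have sumG : 4 * `|G a| - K * h ^+ 4 <=
    `|G (a + h)| + `|G (a + 'i * h)| + `|G (a - h)| + `|G (a - 'i * h)|.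
  have := ler_normB (G (a + h) + G (a + 'i * h) + G (a - h) + G (a - 'i * h))
    (G (a + h) + G (a + 'i * h) + G (a - h) + G (a - 'i * h) - 4 * G a).
  rewrite subKr normrM normr_nat => n4; rewrite lerBlDr (le_trans n4)// lerD//.
    by do 3 (apply: (le_trans (ler_normD _ _)); apply: lerD => //).
  by rewrite nh in h4.
move: sumG sq; rewrite ![_ + _ - u]addrAC.
move: `|G a| `|G (a + h)| `|G (a + 'i * h)| `|G (a - h)| `|G (a - 'i * h)|.
move=> g0 g1 g2 g3 g4 sumG sq.
have -> : g1 + e * `|a - u + h| ^+ 2 + (g2 + e * `|a - u + 'i * h| ^+ 2)
  + (g3 + e * `|a - u - h| ^+ 2) + (g4 + e * `|a - u - 'i * h| ^+ 2) =
  (g1 + g2 + g3 + g4) + e * (4 * `|a - u| ^+ 2 + 4 * h ^+ 2).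
  by rewrite -sq; ring.
move=> /(le_trans (lerD sumG (lexx _))); rewrite -subr_ge0.
have -> : g0 + e * `|a - u| ^+ 2 + (g0 + e * `|a - u| ^+ 2) +
  (g0 + e * `|a - u| ^+ 2) + (g0 + e * `|a - u| ^+ 2) -
  (4 * g0 - K * h ^+ 4 + e * (4 * `|a - u| ^+ 2 + 4 * h ^+ 2)) =
  h ^+ 2 * (K * h ^+ 2 - 4 * e) by ring.
rewrite pmulr_rge0 ?exprn_gt0// subr_ge0 => bad.
(* [h] is below both 1 and [e / (K + 1)]. *)
have h1 : h <= 1 by rewrite (le_trans (ltW hs))// (le_trans st').
have : K * h ^+ 2 < 4 * e.
  apply: (@le_lt_trans _ _ e); last by rewrite ltr_pMl// ltr1n.
  apply: (@le_trans _ _ ((K + 1) * h)).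
    apply: ler_pM; rewrite ?exprn_ge0 ?(ltW h0)//; first by rewrite lerDl.
    by rewrite expr2 ler_piMr// ltW.
  by rewrite -ler_pdivlMl// mulrC (le_trans (ltW hs)).
by move=> /(le_lt_trans bad); rewrite ltxx.
Qed.

(** * The maximum principle and divided differences *)

Lemma taylor_continuous n (a : C) (G : C -> C) :
  taylor n.+1 a G -> {for a, continuous G}.
Proof.
move=> [c [H /taylor_bounded[M HM] GE]].
have nF : Filter (nbhs a) by exact: nbhs_filter.
apply/(@cvgrPdist_lt _ _ _ (nbhs a) nF) => e e0; rewrite (taylor_value _ _ _ _ GE).
have M0 : 0 <= M by rewrite (le_trans _ (nbhs_singleton HM)).
have M1 : 0 < M + 1 by rewrite ltr_wpDl.
have da := near_dist a _ (divr_gt0 e0 M1).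
suff : \forall z \near a, `|c - G z| < e by [].
apply: filterS3 HM GE da => z HM -> za.
rewrite opprD addrA subrr sub0r normrN normrM.
apply: (@le_lt_trans _ _ (`|z - a| * (M + 1))).
  by rewrite ler_wpM2l// (le_trans HM)// lerDl.
by rewrite -ltr_pdivlMr.
Qed.

(** Transfers the compactness of rectangles of [R * R] to the plane. *)
Lemma complex_pair_continuous :
  continuous (fun p : R * R => p.1 +i* p.2 : C).
Proof.
move=> p; apply/cvgrPdist_lt => e e0.
have /complex_realP[x xe] : e \is Num.real by exact: gtr0_real.
move: e0; rewrite {e}xe ltcR => x0; have x20 : 0 < x / 2 by rewrite divr_gt0.
have c1 : (fun q : R * R => q.1) @ p --> p.1 by exact: cvg_fst.
have c2 : (fun q : R * R => q.2) @ p --> p.2 by exact: cvg_snd.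
move/cvgrPdist_lt : c1 => /(_ _ x20) c1.
move/cvgrPdist_lt : c2 => /(_ _ x20) c2.
apply: filterS2 c1 c2 => q q1 q2.
have -> : p.1 +i* p.2 - (q.1 +i* q.2) = (p.1 - q.1)%:C + 'i * (p.2 - q.2)%:C.
  by rewrite [LHS]complexE.
rewrite (le_lt_trans (ler_normD _ _))// normrM !norm_real norm_i mul1r.
by rewrite -rmorphD/= ltcR; rewrite (splitr x) ltrD.
Qed.

Lemma Re_cvg (T : Type) (F : set_system T) (f : T -> C) (l : C) : Filter F ->
  f @ F --> l -> (fun t => complex.Re (f t)) @ F --> complex.Re l.
Proof.
move=> FF /cvgrPdist_lt fl; apply/cvgrPdist_lt => e e0.
have eC0 : 0 < e%:C by rewrite ltcR.
apply: filterS (fl _ eC0) => t /= ft; rewrite -ltcR.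
rewrite -raddfB; apply: le_lt_trans ft; exact: normc_ge_Re.
Qed.

Lemma cvg_Re_penalized (T : Type) (F : set_system T) (g w : T -> C) (k l e : C) :
  Filter F -> g @ F --> k -> w @ F --> l ->
  (fun t => complex.Re (`|g t| + e * `|w t| ^+ 2)) @ F
    --> complex.Re (`|k| + e * `|l| ^+ 2).
Proof.
move=> FF /cvg_norm gk /cvg_norm wl; apply: Re_cvg.
exact: cvgD gk (cvgM (cvg_cst e) (cvgM wl wl)).
Qed.

Lemma norm_Im_le (z : C) : `|complex.Im z|%:C <= `|z|.
Proof.
have := normc_ge_Re (z * 'i); rewrite ReiNIm normrN normrM.
by rewrite norm_i mulr1.
Qed.

Lemma norm_le_Re_Im (z : C) : `|z| <= (`|complex.Re z| + `|complex.Im z|)%:C.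
Proof.
rewrite {1}[z]complexE (le_trans (ler_normD _ _))// normrM !norm_real.
by rewrite norm_i mul1r rmorphD.
Qed.

(** [phi z = `|G z| + e * `|z - u| ^+ 2] attains its maximum over a closed
    square [Q] around [u]. Outside [Q], [phi] is at most [B + 4 * e]; a larger
    maximum over [Q] would thus be a local maximum in the disc, even on the
    boundary of [Q], which [no_local_maximum] excludes. Let [e] tend to 0. *)
Lemma maximum_principle (u : C) : disc R u -> exists2 r : R, 0 < r &
  forall G : C -> C, (forall a, disc R a -> taylor 4 a G) ->
  forall B : R, (forall z, disc R z -> r%:C <= `|z - u| -> `|G z| <= B%:C) ->
  forall z, disc R z -> `|G z| <= B%:C.
Proof.
move=> uD; pose r := (1 - complex.Re `|u|) / 4.
have nuR : `|u| = (complex.Re `|u|)%:C by rewrite Re_normK.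
have r0 : 0 < r by rewrite divr_gt0// subr_gt0 -ltcR -nuR.
exists r => // G GT B GB.
pose x0 := complex.Re u; pose y0 := complex.Im u.
pose Q : set (R * R) := `[x0 - r, x0 + r] `*` `[y0 - r, y0 + r].
pose emb (p : R * R) : C := p.1 +i* p.2.
have QD p : Q p -> disc R (emb p).
  move=> [/= p1 p2]; rewrite /disc/= -[emb p](subrK u).
  rewrite (le_lt_trans (ler_normD _ _))// nuR.
  rewrite (@le_lt_trans _ _ ((r + r)%:C + (complex.Re `|u|)%:C))//.
    rewrite lerD2r (le_trans (norm_le_Re_Im _))// lecR lerD//.
      by rewrite raddfB/= ler_distl; move: p1; rewrite in_itv.
    by rewrite raddfB/= ler_distl; move: p2; rewrite in_itv.
  rewrite -rmorphD -[1](rmorph1 (real_complex R)) ltcR.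
  by move: r0; rewrite /r; lra.
have outQ (z : C) : ~ Q (complex.Re z, complex.Im z) -> r%:C <= `|z - u|.
  move=> nQ; have [re|re] := leP `|complex.Re (z - u)| r; last first.
    by rewrite (le_trans _ (normc_ge_Re _))// lecR ltW.
  have [im|im] := leP `|complex.Im (z - u)| r; last first.
    by rewrite (le_trans _ (norm_Im_le _))// lecR ltW.
  case: nQ; split => /=; rewrite in_itv/=.
    by move: re; rewrite raddfB/= ler_distl.
  by move: im; rewrite raddfB/= ler_distl.
have Qc : compact Q by apply: compact_setX; exact: segment_compact.
have Q0 : Q !=set0.
  exists (x0, y0); split; rewrite /= in_itv/= gerBl lerDl ltW//.
suff approx e : 0 < e -> forall z, disc R z -> `|G z| <= (B + 4 * e)%:C.
  move=> z zD; rewrite -Re_normK lecR; apply/ler_addgt0Pr => e e0.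
  have e40 : 0 < e / 4 by rewrite divr_gt0.
  have := approx _ e40 z zD; rewrite -Re_normK lecR.
  by rewrite [4 * _]mulrC divfK ?pnatr_eq0.
move=> e0; pose phi (z : C) : C := `|G z| + e%:C * `|z - u| ^+ 2.
have phiR z : (complex.Re (phi z))%:C = phi z.
  rewrite RRe_real// realD ?realM ?realX ?normr_real//.
  by apply/complex_realP; exists e.
have Gphi z : `|G z| <= phi z.
  by rewrite lerDl mulr_ge0 ?exprn_ge0// ler0c ltW.
have far z : disc R z -> r%:C <= `|z - u| -> phi z <= (B + 4 * e)%:C.
  move=> zD zr; rewrite rmorphD lerD ?GB//.
  rewrite mulrC rmorphM/= ler_wpM2r ?ler0c ?(ltW e0)//.
  have -> : 4%:C = 2 ^+ 2 :> C by rewrite -natrX rmorph_nat.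
  have zu2 : `|z - u| <= 2.
    by rewrite (le_trans (ler_normB _ _))// -[2]/(1 + 1) lerD// ltW.
  by rewrite expr2 [leRHS]expr2 ler_pM.
have phi_cont : {within Q, continuous (fun p => complex.Re (phi (emb p)))}.
  apply: continuous_in_subspaceT => p /set_mem /QD pD.
  have cemb : emb @ p --> emb p by exact: complex_pair_continuous.
  have cG : (fun q => G (emb q)) @ p --> G (emb p).
    exact: continuous_comp cemb (taylor_continuous _ _ _ (GT _ pD)).
  by apply: cvg_Re_penalized cG _; apply: cvgB cemb _; exact: cvg_cst.
have [p /set_mem Qp pmax] := compact_EVT_max Q0 Qc phi_cont.
have near_le z : disc R z -> phi z <= phi (emb p) \/ phi z <= (B + 4 * e)%:C.
  move=> zD; have [zQ|/outQ/(far z zD)] :=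
    pselect (Q (complex.Re z, complex.Im z)); last by right.
  left; rewrite -[phi z]phiR -[phi (emb p)]phiR lecR.
  by have := pmax _ (mem_set zQ); rewrite /emb/=; case: (z).
have [le|gt] := leP (complex.Re (phi (emb p))) (B + 4 * e).
  move=> z zD; rewrite (le_trans (Gphi z))//.
  case: (near_le z zD) => // /le_trans; apply.
  by rewrite -phiR lecR.
have eC0 : 0 < e%:C by rewrite ltcR.
case: (@no_local_maximum (emb p) u e%:C G (GT _ (QD _ Qp)) eC0).
apply: filterS (near_disc _ (QD _ Qp)) => z /near_le[//|zB].
apply: (le_trans zB); rewrite -[leRHS]/(phi (emb p)) -phiR lecR; exact: ltW.
Qed.

(** A Schwarz lemma: away from [u] the quotient is at most [2 * M / r], and the
    maximum principle extends this bound to the whole disc. *)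
Lemma divided_difference (u : C) : disc R u -> exists2 K : R, 0 < K &
  forall n F (M : R), (forall a, disc R a -> taylor n.+4.+1 a F) ->
  (forall z, disc R z -> `|F z| <= M%:C) ->
  exists G : C -> C, [/\ forall a, disc R a -> taylor n.+4 a G,
    forall z, F z = F u + (z - u) * G z
    & forall z, disc R z -> `|G z| <= (K * M)%:C].
Proof.
move=> uD; have [r r0 maxp] := maximum_principle u uD.
exists (2 / r); first by rewrite divr_gt0.
move=> n F M FT FM; have [G GT FE] := taylor_divided_difference _ _ _ _ uD FT.
exists G; split => //; apply: maxp.
  by move=> a /GT; elim: n {FT GT} => // n IH /taylorW.
move=> z zD rz; have zu : 0 < `|z - u| by rewrite (lt_le_trans _ rz)// ltcR.
have -> : `|G z| = `|F z - F u| / `|z - u|.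
  by rewrite [F z]FE addrC addKr normrM mulrC mulKf// gt_eqF.
rewrite ler_pdivrMr// (@le_trans _ _ ((2 * M)%:C))//.
  rewrite (le_trans (ler_normB _ _))// [_ * M]mulr_natl mulr2n rmorphD.
  by rewrite lerD ?FM.
rewrite (_ : 2 * M = 2 / r * M * r); last by field; rewrite gt_eqF.
rewrite rmorphM/= ler_wpM2l// ler0c mulr_ge0//; first by rewrite divr_ge0// ltW.
by rewrite -ler0c (le_trans _ (FM _ uD)).
Qed.

(** * Uniform estimates on the unit ball of bounded analytic functions *)

Lemma disc_ext_le (f : disc R -> C) (M : R) : (forall z, `|f z| <= M%:C) ->
  forall z, disc R z -> `|disc_ext f z| <= M%:C.
Proof.
move=> fM z zD; rewrite -[z]/(val (exist _ z (mem_set zD) : disc R)) disc_extE.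
exact: fM.
Qed.

Lemma Hinf_analytic (f : Hinf R) : analytic f.
Proof. by have /Hinf_predP[] := HinfP f. Qed.

Lemma Hinf_difference_le (u : disc R) : exists2 K : R, 0 < K &
  forall f : Hinf R, (forall z, `|f z| <= 1) ->
  forall z : disc R, `|f z - f u| <= K%:C * `|val z - val u|.
Proof.
have uD := set_valP u; have [K K0 HK] := divided_difference _ uD.
exists K => // f f1 z.
have [||G [_ FE GK]] := HK 0%N (disc_ext f) 1.
- by move=> a aD; exact: taylor_analytic (Hinf_analytic f) aD.
- exact: disc_ext_le f1.
rewrite -(disc_extE f z) -(disc_extE f u) FE addrC addKr normrM mulrC.
by rewrite ler_wpM2r// -[K]mulr1 GK//; exact: (set_valP z).
Qed.

(** Two divided differences write [f z] as
    [f u + c * (z - u) + G2 z * (z - u) ^+ 2] with [G2] bounded independently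
    of [f]; the linear terms cancel. *)
Lemma Hinf_second_difference_le (u : disc R) : exists2 K : R, 0 < K &
  forall f : Hinf R, (forall z, `|f z| <= 1) ->
  forall (h : C) (z1 z2 : disc R), val z1 = val u + h -> val z2 = val u - h ->
  `|f z1 + f z2 - 2 * f u| <= K%:C * `|h| ^+ 2.
Proof.
have uD := set_valP u; have [K K0 HK] := divided_difference _ uD.
exists (K * K + K * K) => [|f f1 h z1 z2 z1E z2E].
  by rewrite addr_gt0// mulr_gt0.
have [||G1 [T1 E1 B1]] := HK 1%N (disc_ext f) 1.
- by move=> a aD; exact: taylor_analytic (Hinf_analytic f) aD.
- exact: disc_ext_le f1.
have [||G2 [_ E2 B2]] := HK 0%N G1 (K * 1) => //.
have d1 : disc R (val u + h) by rewrite -z1E; exact: (set_valP z1).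
have d2 : disc R (val u - h) by rewrite -z2E; exact: (set_valP z2).
rewrite -(disc_extE f z1) -(disc_extE f z2) -(disc_extE f u) z1E z2E.
rewrite [disc_ext f (_ + _)]E1 [disc_ext f (_ - _)]E1.
rewrite [G1 (_ + _)]E2 [G1 (_ - _)]E2.
set F0 := disc_ext f _; set c1 := G1 _.
have -> : F0 + (val u + h - val u) * (c1 + (val u + h - val u) * G2 (val u + h))
  + (F0 + (val u - h - val u) * (c1 + (val u - h - val u) * G2 (val u - h)))
  - 2 * F0 = (G2 (val u + h) + G2 (val u - h)) * h ^+ 2 by ring.
rewrite normrM normrX ler_wpM2r ?exprn_ge0// (le_trans (ler_normD _ _))//.
by rewrite rmorphD/= lerD// -{2}[K]mulr1; [exact: B2|exact: B2].
Qed.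

(** As [v ^+ 3 - 1 = (v ^+ 2 + v + 1) * (v - 1)] and the first factor has norm at
    least [3 - 1/2 - 1/2], each cubing at least doubles the distance to 1. *)
Lemma eq1_powers_near1 (w : C) : (forall n, `|w ^+ n - 1| <= 2^-1) -> w = 1.
Proof.
move=> wn.
have grow n : 2 ^+ n * `|w - 1| <= `|w ^+ (3 ^ n) - 1|.
  elim: n => [|n IH]; first by rewrite expr0 mul1r expn0 expr1.
  set v := w ^+ (3 ^ n) in IH *.
  have v1 := wn (3 ^ n)%N; have v2 := wn (3 ^ n * 2)%N; rewrite exprM -/v in v1 v2.
  rewrite expnSr exprM -/v.
  rewrite (_ : v ^+ 3 - 1 = (v ^+ 2 + v + 1) * (v - 1)); last by ring.
  rewrite exprS -mulrA normrM ler_pM ?mulr_ge0 ?exprn_ge0//.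
  (* Lower bound for the first factor: subtracting the two small terms
     [v ^+ 2 - 1] and [v - 1] from it leaves 3. *)
  have := ler_normB (v ^+ 2 + v + 1) ((v ^+ 2 - 1) + (v - 1)).
  rewrite (_ : _ - _ = 3); last by ring.
  rewrite normr_nat => n3; rewrite -(lerD2r 1).
  apply: le_trans (le_trans n3 _); first by rewrite (_ : 2 + 1 = 3)//; ring.
  rewrite lerD2l (le_trans (ler_normD _ _))//.
  by rewrite (le_trans (lerD v2 v1))// [leRHS](splitr 1) mul1r.
apply/eqP; rewrite -subr_eq0 -normr_eq0; apply/contraT => d0.
have dpos : 0 < `|w - 1| by rewrite lt_def d0 normr_ge0.
have [N /(_ N (leqnn N))] := half_pow_small dpos.
rewrite exprVn -[_^-1]mulr1 ltr_pdivrMl ?exprn_gt0// => lt1.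
have := le_trans (grow N) (wn _); move=> /(lt_le_trans lt1).
have half1 : (2^-1 : C) < 1 by rewrite invf_lt1// ltr1n.
by move=> /lt_trans/(_ half1); rewrite ltxx.
Qed.

Lemma Hinf_expE (f : Hinf R) n z : (f ^+ n) z = f z ^+ n.
Proof.
elim: n => [|n IH]; first by rewrite !expr0.
by rewrite !exprS -IH.
Qed.

(** * Point evaluations: p-sets and M-ideals *)

Lemma analytic_id : analytic (fun z : disc R => val z).
Proof.
move=> a; exists (fun n => if n is 0 then val a else (n == 1%N)%:R), 1.
split=> // z _; apply/cvg_seqP => e e0; exists 2%N => -[|[|n]]// _.
rewrite /series/= !big_nat_recl//= big1 => [|i _]; last by rewrite mul0r.
by rewrite expr0 expr1 mulr1 mul1r addr0 [val a + _]addrC subrK subrr normr0.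
Qed.

Lemma disc_lt1 (z : disc R) : `|val z| < 1.
Proof. exact: (set_valP z). Qed.

Lemma Hinf_id_proof : (fun z : disc R => val z) \in @Hinf_pred R.
Proof.
apply/Hinf_predP; split; first exact: analytic_id.
by exists 1 => z; apply: ltW; exact: disc_lt1.
Qed.

Definition Hinf_id : Hinf R := MkHinf Hinf_id_proof.

Lemma Hinf_norm_le1 (f : Hinf R) : (forall z, `|f z| <= 1) -> `|f| <= 1.
Proof. by move=> f1; apply: sup_norm_le => //; exists (disc0 R). Qed.

Lemma disc_small_step (u : disc R) (K : R) : 0 < K ->
  exists2 h : C, 0 < h & K%:C * h < 2^-1 /\
    exists z1 z2 : disc R, val z1 = val u + h /\ val z2 = val u - h.
Proof.
move=> K0; have [d d0 dP] := near_distP _ _ (near_disc _ (set_valP u)).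
have KC0 : 0 < K%:C :> C by rewrite ltcR.
have half0 : 0 < 2^-1 :> C by rewrite invr_gt0.
have [t t0 [td tK]] := minC_gt0 d0 (divr_gt0 half0 KC0).
pose h := t / 2; have h0 : 0 < h by rewrite divr_gt0.
have ht : h < t by rewrite ltr_pdivrMr// ltr_pMr// ltr1n.
exists h => //; split.
  by rewrite mulrC -ltr_pdivlMr// (lt_le_trans ht).
have d1 : disc R (val u + h).
  by apply: dP; rewrite addrC addKr gtr0_norm// (lt_le_trans ht).
have d2 : disc R (val u - h).
  by apply: dP; rewrite addrC addKr normrN gtr0_norm// (lt_le_trans ht).
by exists (exist _ (val u + h) (mem_set d1) : disc R),
  (exist _ (val u - h) (mem_set d2) : disc R).
Qed.

(** The powers of a peak function equal to 1 at [u] are all bounded by 1 and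
    equal to 1 at [u], so they stay within 1/2 of 1 at a point [v] close to [u],
    where closeness does not depend on the peak function. Hence the peak
    function is 1 at [v]: every peak set that contains [ev u] contains
    [ev v]. *)
Lemma ev_not_p_set (u : disc R) : ~ p_set (gelfand_algebra R) [set ev u].
Proof.
move=> [F [Fpeak uF]]; have [K K0 HK] := Hinf_difference_le u.
have [h h0 [Kh [v [_ [vE _]]]]] := disc_small_step u K K0.
suff evF : [set ev u] (ev v).
  have /(congr1 (fun phi => gelfand Hinf_id phi)) : ev v = ev u by exact: evF.
  rewrite /gelfand/= vE => /(congr1 (fun z => z - val u)).
  by rewrite addrC addKr subrr => h00; rewrite h00 ltxx in h0.
rewrite uF => S FS; have [_ [_ [[f _ <-] fS1 fSn]]] := Fpeak S FS.
have uS : S (ev u) by have : [set ev u] (ev u) by []; rewrite uF; apply.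
have f1 z : `|f z| <= 1.
  have [zS|zS] := pselect (S (ev z)); last exact: ltW (fSn _ zS).
  by have := fS1 _ zS; rewrite /gelfand/= => ->; rewrite normr1.
have fu : f u = 1 by exact: fS1 _ uS.
have fv : f v = 1.
  apply: eq1_powers_near1 => n.
  have := HK (f ^+ n) _ v; rewrite !Hinf_expE fu expr1n vE.
  rewrite [_ + h - _]addrC addKr (gtr0_norm h0) => H; apply: le_trans (H _) (ltW Kh).
  by move=> z; rewrite Hinf_expE normrX exprn_ile1.
apply: contrapT => /fSn; rewrite /gelfand/= fv normr1 ltxx.
by [].
Qed.

Lemma ev_dual_proof (z : disc R) :
  (fun f : Hinf R => f z) \in @dual_pred R (Hinf R).
Proof.
apply/dual_predP; split => //; exists 1 => f; rewrite mul1r; exact: Hinf_norm_ub.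
Qed.

Definition ev_dual z : dual (Hinf R) := MkDual (ev_dual_proof z).

Lemma dual_norm_le (X : normedModType C) (phi : dual X) (M : C) :
  (forall x, `|x| <= 1 -> `|phi x| <= M) -> `|phi| <= M.
Proof. by move=> H; apply: sup_norm_le (unit_ball_neq0 _) _. Qed.

Lemma dual_distance_ub (X : normedModType C) (phi psi : dual X) x :
  `|x| <= 1 -> `|phi x - psi x| <= `|phi - psi|.
Proof. exact: (@dual_norm_ub _ _ (phi - psi)). Qed.

Lemma ev_dual1 z : ev_dual z 1 = 1. Proof. by []. Qed.

Lemma ev_dual_id z : ev_dual z Hinf_id = val z. Proof. by []. Qed.

Lemma annihilator_ker_ev (u : disc R) (phi : dual (Hinf R)) :
  annihilator (ker (ev u)) phi -> forall f, phi f = phi 1 * f u.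
Proof.
move=> phi0 f; have /dual_predP[phil _] := dualP phi.
have : phi (- f u *: 1 + f) = 0.
  apply: phi0; rewrite /ker/= /gelfand/=; change (- f u * 1 + f u = 0).
  by rewrite mulr1 addNr.
rewrite phil => /eqP; rewrite addrC mulNr subr_eq0 => /eqP ->.
exact: mulrC.
Qed.

(** The projection sends [ev_dual z] to [c z *: ev_dual u]. Evaluating the norm
    identity at the constant 1 shows that [d z = 1 - c z] satisfies
    [`|d z| <= Re (d z)], and that [`|d z|] controls the distance from
    [ev_dual z] to [ev_dual u]. As [c u = 1], the sum [d z1 + d z2] at
    [u + h] and [u - h] is, up to sign, the value at the constant 1 of the
    projection of the second difference of [ev_dual], hence [O(h ^+ 2)]; positivity of real parts gives the same for [d z1], whereas
    testing on the identity function gives [h <= 2 * `|d z1|]. *)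
Lemma ker_ev_not_M_ideal (u : disc R) : ~ M_ideal (ker (ev u)).
Proof.
move=> [_ [P [_ PP Pann Pnorm]]].
have [K K0 HK] := Hinf_second_difference_le u.
have K20 : 0 < 2 * K by rewrite mulr_gt0.
have [h h0 [Kh [z1 [z2 [z1E z2E]]]]] := disc_small_step u (2 * K) K20.
have one1 : `|1 : Hinf R| <= 1 by apply: Hinf_norm_le1 => z; rewrite normr1.
have id1 : `|Hinf_id| <= 1 by apply: Hinf_norm_le1 => z; exact: ltW (disc_lt1 z).
pose c z := P (ev_dual z) 1; pose d z := 1 - c z.
have Pev z f : P (ev_dual z) f = c z * f u.
  by apply: annihilator_ker_ev; rewrite -Pann; exists (ev_dual z).
have ev1 z : `|ev_dual z| <= 1.
  by apply: dual_norm_le => f f1; apply: le_trans (Hinf_norm_ub f z) f1.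
pose N z := `|ev_dual z - P (ev_dual z)|.
have cN z : `|c z| + N z <= 1.
  apply: le_trans (ev1 z); rewrite -Pnorm lerD2r.
  exact: (@dual_norm_ub _ _ (P (ev_dual z))).
have dN z : `|d z| <= N z.
  by rewrite /d -{1}(ev_dual1 z); exact: dual_distance_ub.
have Nd z : N z <= `|d z|.
  rewrite -(lerD2l `|c z|) (le_trans (cN z))// -{1}(normr1 C).
  by rewrite -{1}(subrK (c z) 1) addrC ler_normD.
have dRe z : `|d z| <= (complex.Re (d z))%:C.
  have := le_trans (lerD (lexx _) (dN z)) (cN z).
  rewrite -[`|c z|]Re_normK -[`|d z|]Re_normK -rmorphD/=.
  rewrite -[1](rmorph1 (real_complex R)) !lecR.
  have := normc_ge_Re (c z); rewrite -[`|c z|]Re_normK lecR.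
  move=> /(le_trans (ler_norm _)); rewrite /d raddfB/=.
  by move=> ? ?; lra.
(* [val z - c z * val u] is the value of [ev_dual z - P (ev_dual z)] at the
   identity function. *)
have dist z : `|val z - val u| <= `|d z| *+ 2.
  have -> : val z - val u = (val z - c z * val u) - d z * val u.
    by rewrite /d; ring.
  rewrite (le_trans (ler_normB _ _))// mulr2n lerD//.
    apply: le_trans (Nd z); rewrite -[c z * val u](Pev z Hinf_id).
    by rewrite -(ev_dual_id z); exact: dual_distance_ub id1.
  by rewrite normrM ler_piMr// ltW// disc_lt1.
have Pu : P (ev_dual u) = ev_dual u.
  have : annihilator (ker (ev u)) (ev_dual u) by [].
  by rewrite -Pann => -[phi _ <-]; rewrite PP.
have dd : `|d z1 + d z2| <= K%:C * h ^+ 2.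
  pose psi := ev_dual z1 + ev_dual z2 - (ev_dual u + ev_dual u).
  have Ppsi : P psi 1 = - (d z1 + d z2).
    have PD x y : P (x + y) = P x + P y by exact: raddfD.
    have PB x y : P (x - y) = P x - P y by exact: raddfB.
    rewrite /psi PB !PD Pu.
    change (c z1 + c z2 - (1 + 1) = - (d z1 + d z2)).
    by rewrite /d; ring.
  rewrite -normrN -Ppsi (le_trans (@dual_norm_ub _ _ (P psi) 1 one1))//.
  apply: (@le_trans _ _ `|psi|); first by rewrite -(Pnorm psi) lerDl.
  apply: dual_norm_le => f f1; rewrite -(gtr0_norm h0).
  have f1z z : `|f z| <= 1 by apply: le_trans (Hinf_norm_ub f z) f1.
  have := HK f f1z h z1 z2 z1E z2E.
  by rewrite mulr_natl mulr2n.
have d1 : `|d z1| <= K%:C * h ^+ 2.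
  apply: le_trans dd; apply: le_trans (dRe z1) _.
  have := le_trans (normr_ge0 _) (dRe z2); rewrite ler0c => d20.
  apply: le_trans (normc_ge_Re _); rewrite lecR.
  apply: le_trans (ler_norm _).
  rewrite (_ : complex.Re (d z1 + d z2) = complex.Re (d z1) + complex.Re (d z2)).
    by rewrite lerDl.
  by case: (d z1) (d z2) => ? ? [].
have := dist z1; rewrite z1E addrC addKr (gtr0_norm h0).
move=> /le_trans/(_ (lerD d1 d1)).
rewrite (_ : _ + _ = (2 * K)%:C * h * h); last by rewrite rmorphM/= rmorph_nat; ring.
have lt_h : (2 * K)%:C * h * h < 1 * h.
  by rewrite ltr_pM2r// (lt_trans Kh)// invf_lt1// ltr1n.
by move=> /le_lt_trans/(_ lt_h); rewrite mul1r ltxx.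
Qed.

End point_evaluations.

Theorem corollary4p2 (R : realType) (alpha : disc R) :
  ~ p_set (gelfand_algebra R) [set ev alpha] /\
  ~ M_ideal (ker (ev alpha)).
Proof. by split; [exact: ev_not_p_set|exact: ker_ev_not_M_ideal]. Qed.
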